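(* Let $k\ge 2$. For every oriented word $u$ of rank $k$, the left order $\leq_u$ is not a right order on $F_k$.
   Context: Let $k\ge 2$ and let $\mathcal{A}=\{a_1,\dots,a_k\}$ be a basis of the free group $F_k$. For $a\in\mathcal{A}$ the inverse is denoted by the corresponding uppercase letter ($A=a^{-1}$, $B=b^{-1}$, $A_i=a_i^{-1}$). Letters in $\mathcal{A}$ are called positive (lowercase), letters in $\mathcal{A}^{-1}$ negative (uppercase), and $\mathcal{A}^{\pm}=\mathcal{A}\cup\mathcal{A}^{-1}$. Elements of $F_k$ are identified with reduced group words over $\mathcal{A}^\pm$; $e$ is the trivial element. An oriented word of rank $k$ is a word of length $2k$ over $\mathcal{A}^\pm$ containing each letter of $\mathcal{A}^\pm$ exactly once. For distinct $x,y\in\mathcal{A}^\pm$, ''$x..y$ in $u$'' means that $x$ is to the left of $y$ in $u$. $\#_w(g)$ is the number of (possibly overlapping) occurrences of $w$ as a contiguous subword of $g$. For an oriented word $u$ of rank $k$ and a reduced word $g$, define $$\alpha_u(g)=\sum_{a,b\in\mathcal{A},\ A..B\text{ in }u}\#_{aB}(g)-\sum_{a,b\in\mathcal{A},\ a..b\text{ in }u}\#_{Ba}(g),$$ $$\beta_u(g)=\sum_{a,b\in\mathcal{A},\ A..b\text{ in }u}\#_{ab}(g)-\sum_{a,b\in\mathcal{A},\ A..b\text{ in }u}\#_{BA}(g)$$ (sums over ordered pairs $(a,b)$; in $\beta_u$ the case $a=b$ is allowed), and let $\omega(g)=\frac12$ if the last letter of $g$ is in $\mathcal{A}$, $\omega(g)=-\frac12$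 if it is in $\mathcal{A}^{-1}$, $\omega(e)=0$. The weight induced by $u$ is $\tau_u=\alpha_u+\beta_u+\omega$ (always evaluated on reduced forms). The left order $\leq_u$ on $F_k$ induced by $u$ is the one with positive cone $P_u=\{g\in F_k\mid\tau_u(g)>0\}$, i.e. $g<_u h$ if and only if $g^{-1}h\in P_u$. A right order on a group $G$ is a linear order $\le$ such that $g\le h$ implies $gf\le hf$ for all $f,g,h\in G$. *)

(* Defs.v *)
From HB Require Import structures.
From mathcomp Require Import all_boot all_order all_algebra.

Set Implicit Arguments.
Unset Strict Implicit.
Unset Printing Implicit Defensive.

Import Order.TTheory GRing.Theory Num.Theory.

Local Open Scope ring_scope.

(* The index set 'I_k stands for the basis {a_1, ..., a_k}: [pos a] is the    *)
(* lowercase letter a and [neg a] its inverse, the uppercase letter A.        *)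
Definition letter (k : nat) : Type := ('I_k * bool)%type.
HB.instance Definition _ k := Finite.on (letter k).

Definition pos k (a : 'I_k) : letter k := (a, true).
Definition neg k (a : 'I_k) : letter k := (a, false).
Definition is_pos k (x : letter k) : bool := x.2.
Definition inv_letter k (x : letter k) : letter k := (x.1, ~~ x.2).

Lemma inv_letterK k : involutive (@inv_letter k).
Proof. by case=> i s; rewrite /inv_letter /= negbK. Qed.

Definition reduced k (w : seq (letter k)) : bool :=
  sorted (fun x y => y != inv_letter x) w.

Definition push k (x : letter k) (w : seq (letter k)) : seq (letter k) :=
  if w is y :: w' then (if y == inv_letter x then w' else x :: w) else [:: x].

Definition reduce k (w : seq (letter k)) : seq (letter k) :=
  foldr (@push k) [::] w.

Definition inv_word k (w : seq (letter k)) : seq (letter k) :=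
  rev (map (@inv_letter k) w).

Lemma reduced_push k (x : letter k) w : reduced w -> reduced (push x w).
Proof.
case: w => [|y w] //= yw.
case: eqP => [_|/eqP yNx]; first exact: path_sorted yw.
by rewrite /= yNx.
Qed.

Lemma reduced_reduce k (w : seq (letter k)) : reduced (reduce w).
Proof. by elim: w => //= x w; apply: reduced_push. Qed.

Lemma reduce_id k (w : seq (letter k)) : reduced w -> reduce w = w.
Proof.
elim: w => [//|x w IHw] xw; rewrite /= -/(reduce w) IHw; last exact: path_sorted xw.
by case: w xw {IHw} => [//|y w] /= /andP[/negPf->].
Qed.

Lemma pushK k (x : letter k) w :
  reduced w -> push x (push (inv_letter x) w) = w.
Proof.
case: w => [|y w] /=; first by rewrite eqxx.
rewrite inv_letterK; case: eqP => [-> xw|_ _] /=; last by rewrite eqxx.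
by case: w xw => [//|z w] /= /andP[/negPf->].
Qed.

Lemma reduce_cat k (u v : seq (letter k)) :
  reduce (u ++ v) = foldr (@push k) (reduce v) u.
Proof. by rewrite /reduce foldr_cat. Qed.

Lemma reduce_catr k (u v : seq (letter k)) :
  reduce (u ++ reduce v) = reduce (u ++ v).
Proof. by rewrite !reduce_cat (reduce_id (reduced_reduce v)). Qed.

Lemma reduce_catl k (u v : seq (letter k)) :
  reduce (reduce u ++ v) = reduce (u ++ v).
Proof.
have push_cat x w : reduce (push x w ++ v) = push x (reduce (w ++ v)).
  case: w => [//|y w] /=; case: eqP => [->|//].
  by rewrite pushK ?reduced_reduce.
by elim: u => [//|x u IHu] /=; rewrite push_cat IHu.
Qed.

Lemma reduce_mulVw k (w : seq (letter k)) : reduce (inv_word w ++ w) = [::].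
Proof.
elim: w => [//|x w IHw]; rewrite /inv_word /= rev_cons cat_rcons reduce_cat /=.
rewrite -/(reduce w) -{2}[x]inv_letterK pushK ?reduced_reduce //.
by rewrite -reduce_cat.
Qed.

Lemma inv_wordK k : involutive (@inv_word k).
Proof.
move=> w; rewrite /inv_word map_rev revK -map_comp -[RHS]map_id.
by apply: eq_map => x /=; rewrite inv_letterK.
Qed.

Lemma reduced_inv k (w : seq (letter k)) : reduced w -> reduced (inv_word w).
Proof.
rewrite /reduced /inv_word rev_sorted sorted_map; apply: sub_sorted => x y /=.
by apply: contra => /eqP->; rewrite !inv_letterK.
Qed.

Record free_group (k : nat) :=
  FreeGroup { word :> seq (letter k); word_reduced : reduced word }.

HB.instance Definition _ k := [isSub for @word k].
HB.instance Definition _ k := [Choice of free_group k by <:].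

Definition fg_one k : free_group k := @FreeGroup k [::] isT.
Definition fg_mul k (g h : free_group k) : free_group k :=
  FreeGroup (reduced_reduce (word g ++ word h)).
Definition fg_inv k (g : free_group k) : free_group k :=
  FreeGroup (reduced_inv (word_reduced g)).

Lemma fg_mulA k : associative (@fg_mul k).
Proof. by move=> f g h; apply: val_inj; rewrite /= reduce_catr reduce_catl catA. Qed.

Lemma fg_mul1g k : left_id (fg_one k) (@fg_mul k).
Proof. by move=> g; apply: val_inj; rewrite /= reduce_id // word_reduced. Qed.

Lemma fg_mulg1 k : right_id (fg_one k) (@fg_mul k).
Proof. by move=> g; apply: val_inj; rewrite /= cats0 reduce_id // word_reduced. Qed.

Lemma fg_mulVg k : left_inverse (fg_one k) (@fg_inv k) (@fg_mul k).
Proof. by move=> g; apply: val_inj; rewrite /= reduce_mulVw. Qed.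

Lemma fg_mulgV k : right_inverse (fg_one k) (@fg_inv k) (@fg_mul k).
Proof.
by move=> g; apply: val_inj; rewrite /= -{1}[word g]inv_wordK reduce_mulVw.
Qed.

HB.instance Definition _ k := isGroup.Build (free_group k)
  (@fg_mulA k) (@fg_mul1g k) (@fg_mulg1 k) (@fg_mulVg k) (@fg_mulgV k).

Definition oriented_word k (u : seq (letter k)) : Prop :=
  size u = (2 * k)%N /\ forall x : letter k, count_mem x u = 1%N.

(* "x..y in u" for the letters of an oriented word; it is false for x = y.    *)
Definition left_of k (u : seq (letter k)) (x y : letter k) : bool :=
  (index x u < index y u)%N.

(* Occurrences may overlap: one counts the positions of g where w starts.     *)
Definition occ k (w g : seq (letter k)) : nat :=
  count (fun i => prefix w (drop i g)) (iota 0 (size g).+1).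

Definition alpha k (u : seq (letter k)) (g : free_group k) : rat :=
  \sum_(a < k) \sum_(b < k | left_of u (neg a) (neg b))
     (occ [:: pos a; neg b] g)%:R
  - \sum_(a < k) \sum_(b < k | left_of u (pos a) (pos b))
     (occ [:: neg b; pos a] g)%:R.

Definition beta k (u : seq (letter k)) (g : free_group k) : rat :=
  \sum_(a < k) \sum_(b < k | left_of u (neg a) (pos b))
     (occ [:: pos a; pos b] g)%:R
  - \sum_(a < k) \sum_(b < k | left_of u (neg a) (pos b))
     (occ [:: neg b; neg a] g)%:R.

Definition omega k (g : free_group k) : rat :=
  if word g is x :: s then (if is_pos (last x s) then 2^-1 else - 2^-1) else 0.

Definition tau k (u : seq (letter k)) (g : free_group k) : rat :=
  alpha u g + beta u g + omega g.

Definition positive_cone k (u : seq (letter k)) : pred (free_group k) :=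
  fun g => 0 < tau u g.

Definition ltu k (u : seq (letter k)) : rel (free_group k) :=
  fun g h => (g^-1 * h)%g \in positive_cone u.

Definition leu k (u : seq (letter k)) : rel (free_group k) :=
  fun g h => (g == h) || ltu u g h.

Definition linear_order (T : Type) (le : rel T) : Prop :=
  [/\ reflexive le, antisymmetric le, transitive le & total le].

Definition right_order (G : groupType) (le : rel G) : Prop :=
  linear_order le /\
  forall f g h : G, le g h -> le (g * f)%g (h * f)%g.

(* Main.v *)
Require Import Defs.
From mathcomp Require Import all_boot all_order all_algebra.
From mathcomp Require Import ring.

(** The weight has a closed form.  Write [x_1 ... x_n] for the reduced word of
    [g] and give every letter [x] the exponent +1 or -1 according to its case.
    Then

      2 tau_u(g) = sum_(i <= n) exponent x_i
                   + sum_(i < n) (+1 if x_i^-1 .. x_(i+1) in u, else -1),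

    which is [tau_score]: the four families of two-letter patterns in
    alpha and beta are the four case patterns of a single rule.  Twice the
    weight is therefore an integer, the [score], and conjugate elements are
    easy to compare.

    If the order were a right order, its positive cone would be closed under
    conjugation ([conj_score]).  Let [a] and [b] be two distinct generators; by
    symmetry A..B in u.  Comparing conjugates determines enough of u:
    - [aB] and [Ba] are conjugate, and their scores are the signs of A..B and
      b..a, so b..a;
    - [b > 1] gives [Aba > 1], which together with b..a forces B..a, and
      [abA > 1], which together with A..B forces A..b.
    The conjugate commutators [ABab] and [abAB] then have a positive and
    a negative score. *)

Set Implicit Arguments.
Unset Strict Implicit.
Unset Printing Implicit Defensive.

Import Order.TTheory GRing.Theory Num.Theory.
Local Open Scope ring_scope.

Section Score.

Variables (k : nat) (u : seq (letter k)).

Definition exponent (x : letter k) : int := if is_pos x then 1 else -1.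

Definition turn (x y : letter k) : int :=
  if left_of u (inv_letter x) y then 1 else -1.

Fixpoint score (w : seq (letter k)) : int :=
  if w is x :: s then
    exponent x + (if s is y :: _ then turn x y else 0) + score s
  else 0.

Lemma occ_cons (p w : seq (letter k)) x :
  occ p (x :: w) = (prefix p (x :: w) + occ p w)%N.
Proof.
have -> : occ p (x :: w) = count (fun i => prefix p (drop i (x :: w)))
                                   (0 :: iota (1 + 0) (size w).+1) by [].
by rewrite iotaDl /occ [LHS]/= count_map.
Qed.

Lemma sum_occ_cons (Q : 'I_k -> 'I_k -> bool) (l r : 'I_k -> 'I_k -> letter k)
    x y s :
  \sum_a \sum_(b | Q a b) (occ [:: l a b; r a b] [:: x, y & s])%:R =
  \sum_a \sum_(b | Q a b) ((l a b == x) && (r a b == y))%:R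
    + \sum_a \sum_(b | Q a b) (occ [:: l a b; r a b] (y :: s))%:R :> rat.
Proof.
rewrite -big_split; apply: eq_bigr => a _ /=.
rewrite -big_split; apply: eq_bigr => b _ /=.
by rewrite occ_cons /= prefix0s andbT natrD.
Qed.

Lemma sum_pair1 (Q : 'I_k -> 'I_k -> bool) (c : 'I_k -> 'I_k -> bool) d i j :
  (forall a b, c a b = [&& d, a == i & b == j]) ->
  \sum_a \sum_(b | Q a b) (c a b)%:R = (d && Q i j)%:R :> rat.
Proof.
move=> cE; rewrite (bigD1 i) //= [X in _ + X]big1 ?addr0 => [|a /negPf ai].
  rewrite big_mkcond (bigD1 j) //= big1 ?addr0 => [|b /negPf bj].
    by rewrite cE !eqxx !andbT; case: Q; rewrite ?andbT ?andbF.
  by rewrite cE bj !andbF; case: ifP.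
by rewrite big1 // => b _; rewrite cE ai andbF.
Qed.

Lemma left_of_asym x y : left_of u x y -> left_of u y x = false.
Proof. by move=> xy; apply/negbTE; rewrite -leqNgt ltnW. Qed.

Hypothesis hu : oriented_word u.

Lemma left_ofN x y : x != y -> left_of u y x = ~~ left_of u x y.
Proof.
move=> xy; rewrite /left_of -leqNgt [RHS]leq_eqVlt; case: eqP => //= eq_index.
have mem_u z : z \in u by rewrite -has_pred1 has_count hu.2.
by move: xy; rewrite -[y](nth_index x (mem_u y)) eq_index nth_index ?eqxx.
Qed.

(** This value is 0 or 1 if [x] is positive, 0 or -1 if it is negative.  Summed
    over a word, its exponents are those of all letters but the last, which
    [omega] supplies. *)
Definition pair_weight (x y : letter k) : rat :=
  (turn x y + exponent x)%:~R / 2.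

(** With x' the inverse of [x], the pair contributes +1 if [x] is positive and
    x'..y in u, and -1 if [x] is negative and y..x' in u; in a reduced word
    [y] differs from x', so y..x' is the failure of x'..y. *)
Lemma alpha_beta_cons x y s (rs : reduced (y :: s))
    (rxs : reduced [:: x, y & s]) :
  alpha u (FreeGroup rxs) + beta u (FreeGroup rxs) =
  pair_weight x y + (alpha u (FreeGroup rs) + beta u (FreeGroup rs)).
Proof.
have x'y : inv_letter x != y by move: rxs; rewrite /= eq_sym => /andP[].
rewrite /alpha /beta /=.
(* The four sums over occurrences starting at [x] pick the four cases of
   the pair [x, y]. *)
rewrite (sum_occ_cons _ (fun a _ => pos a) (fun _ b => neg b)).
rewrite (sum_occ_cons _ (fun _ b => neg b) (fun a _ => pos a)).
rewrite (sum_occ_cons _ (fun a _ => pos a) (fun _ b => pos b)).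
rewrite (sum_occ_cons _ (fun _ b => neg b) (fun a _ => neg a)).
rewrite (@sum_pair1 _ _ (is_pos x && ~~ is_pos y) x.1 y.1); last first.
  by case: x y {rs rxs x'y} => [i []] [j []] a b;
     rewrite !xpair_eqE /= ?andbT ?andbF.
rewrite (@sum_pair1 _ _ (~~ is_pos x && is_pos y) y.1 x.1); last first.
  by case: x y {rs rxs x'y} => [i []] [j []] a b;
     rewrite !xpair_eqE /= ?andbT ?andbF // andbC.
rewrite (@sum_pair1 _ _ (is_pos x && is_pos y) x.1 y.1); last first.
  by case: x y {rs rxs x'y} => [i []] [j []] a b;
     rewrite !xpair_eqE /= ?andbT ?andbF.
rewrite (@sum_pair1 _ _ (~~ is_pos x && ~~ is_pos y) y.1 x.1); last first.
  by case: x y {rs rxs x'y} => [i []] [j []] a b;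
     rewrite !xpair_eqE /= ?andbT ?andbF // andbC.
have yx' := left_ofN x'y; rewrite /pair_weight /turn /exponent.
case: x y x'y yx' {rs rxs} => [i []] [j []] _;
  rewrite /inv_letter /is_pos /= => yx';
  by rewrite ?yx'; case: left_of => /=; field.
Qed.

Lemma alpha_beta_short g : (size (word g) <= 1)%N -> alpha u g + beta u g = 0.
Proof.
move=> g_short; have occ0 x y : occ [:: x; y] g = 0%N.
  by case: (word g) g_short => [|z [|? ?]] //= _; rewrite !occ_cons /= andbF.
have sum0 Q (l r : 'I_k -> 'I_k -> letter k) :
    \sum_a \sum_(b | Q a b) (occ [:: l a b; r a b] g)%:R = 0 :> rat.
  by rewrite big1 // => a _; rewrite big1 // => b _; rewrite occ0.
rewrite /alpha /beta.
rewrite (sum0 _ (fun a _ => pos a) (fun _ b => neg b)).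
rewrite (sum0 _ (fun _ b => neg b) (fun a _ => pos a)).
rewrite (sum0 _ (fun a _ => pos a) (fun _ b => pos b)).
by rewrite (sum0 _ (fun _ b => neg b) (fun a _ => neg a)).
Qed.

(** By induction on the word: each new first letter adds one pair weight and
    leaves [omega] unchanged. *)
Lemma tau_score g : tau u g = (score (word g))%:~R / 2.
Proof.
case: g => w rw /=; elim: w rw => [|x [|y s] IHs] rxs.
- by rewrite /tau alpha_beta_short // add0r mul0r.
- rewrite /tau alpha_beta_short // add0r /omega /= /exponent.
  by case: is_pos; rewrite !addr0 ?mul1r ?mulN1r.
rewrite /tau (alpha_beta_cons (path_sorted rxs)) -addrA.
have := IHs (path_sorted rxs); rewrite /tau /omega /= => ->.
by rewrite /pair_weight -mulrDl -intrD; congr (_%:~R / 2); ring.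
Qed.

End Score.

Section RightOrder.

Variables (k : nat) (u : seq (letter k)).
Hypotheses (hu : oriented_word u) (ro : right_order (leu u)).

Lemma positive_score (g : free_group k) :
  (g \in positive_cone u) = (0 < score u (word g)).
Proof. by rewrite unfold_in tau_score // pmulr_lgt0 ?invr_gt0 // ltr0z. Qed.

(** The equation between words says that [w] is the conjugate of [v] by [f],
    in a form that holds literally when [w] is a rotation of [v]. *)
Lemma conj_score v w f : reduced v -> reduced w ->
  reduce (v ++ f) = reduce (f ++ w) -> 0 < score u v -> 0 < score u w.
Proof.
move=> rv rw eq_vfw; set g := FreeGroup rv; set h := FreeGroup rw.
pose c := FreeGroup (reduced_reduce f).
have ghE : (g * c = c * h)%g.
  by apply: val_inj; rewrite /= reduce_catr reduce_catl.
rewrite -(positive_score g) -(positive_score h) => g_gt0.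
have le1g : leu u 1%g g by rewrite /leu /ltu invg1 mul1g g_gt0 orbT.
have := ro.2 c _ _ le1g; rewrite mul1g ghE /leu /ltu mulgA mulVg mul1g.
case/orP=> [/eqP c_ch|//].
(* Otherwise [h] is trivial, hence so is its conjugate [g], of score zero. *)
have h1 : h = 1%g by apply: (mulgI c); rewrite mulg1 -c_ch.
have g1 : g = 1%g by apply: (mulIg c); rewrite mul1g ghE h1 mulg1.
by move: g_gt0; rewrite g1 positive_score.
Qed.

End RightOrder.

(** Reducing a word alternates simplification with deciding, by [letterE],
    whether the next letter cancels; the words at hand have at most four
    letters, so five rounds suffice. *)
Ltac reduce_letters letterE :=
  repeat match goal with x := _ |- _ => subst x end;
  rewrite /reduced /pos /neg; do 5 rewrite /= ?letterE; by [].

Theorem proposition21 (k : nat) (hk : (2 <= k)%N) (u : seq (letter k))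
    (hu : oriented_word u) :
  ~ right_order (leu u).
Proof.
move=> ro; pose i : 'I_k := Ordinal (ltnW hk); pose j : 'I_k := Ordinal hk.
have : i != j by [].
wlog AB : {hk} i j / left_of u (neg i) (neg j) => [th|].
  case: (boolP (left_of u (neg i) (neg j))) => [|BA] ij; first exact: th ij.
  apply: (th j i); last by rewrite eq_sym.
  by rewrite left_ofN.
move=> ij; have ji : j != i by rewrite eq_sym.
set a := pos i; set A := neg i; set b := pos j; set B := neg j.
have letterE := (inv_letterK, xpair_eqE, negPf ij, negPf ji, eqxx).
have conj := conj_score hu ro.
have aB_Ba : (0 < score u [:: a; B]) = (0 < score u [:: B; a]).
  apply/idP/idP; [apply: (conj _ _ [:: a]) | apply: (conj _ _ [:: B])];
    try reduce_letters letterE; by [].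
have left_ba : left_of u b a.
  by move: aB_Ba; rewrite /= /turn AB; case: left_of.
have left_Ab : left_of u A b.
  have : 0 < score u [:: a; b; A].
    apply: (conj [:: b] _ [:: A]); reduce_letters letterE.
  by rewrite /= /turn (left_of_asym AB); case: left_of.
have left_Ba : left_of u B a.
  have : 0 < score u [:: A; b; a].
    apply: (conj [:: b] _ [:: a]); reduce_letters letterE.
  by rewrite /= /turn (left_of_asym left_ba); case: left_of.
have : 0 < score u [:: a; b; A; B].
  apply: (conj [:: A; B; a; b] _ [:: A; B]).
  - reduce_letters letterE.
  - reduce_letters letterE.
  - by [].
  by rewrite /= /turn left_ba left_Ab; case: left_of.
rewrite /= /turn left_Ab (left_of_asym AB).
by rewrite (left_of_asym left_Ba).
Qed.
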